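(* Let $\Theta\subset\mathbb{R}^d$ be closed, bounded and convex, let $\ell_t=f_t+r$ be convex Lipschitz losses, and let the standing assumptions listed in the context hold. Let $\Phi_{i,t}:\Theta\to\Theta$, $i=1,\dots,N$, $t=1,\dots,T$, be candidate dynamical models, all contractive with respect to the Bregman divergence $D$: $D(\Phi_{i,t}(\theta)\|\Phi_{i,t}(\theta'))\le D(\theta\|\theta')$ for all $\theta,\theta'\in\Theta$ and all $i,t$. Let $m$ be a number of switches that does not depend on $T$. Run the Dynamic Fixed Share (DFS) algorithm (see context) with $\lambda=\frac{m}{T-1}\in(0,1)$, $$\eta_r=\sqrt{\frac{8\left((m+1)\log N+m\log T+1\right)}{T}},$$ and $\eta_t\propto1/\sqrt t$ or $\eta_t\propto1/\sqrt T$ (with proportionality constant independent of $t$ and $T$). Then there is a constant $C>0$, independent of $T$, such that for every comparator sequence $\boldsymbol\theta_T=(\theta_1,\dots,\theta_T)\in\Theta^T$ the DFS predictions $\widehat\theta_t$ satisfy $$\sum_{t=1}^T\ell_t(\widehat\theta_t)-\sum_{t=1}^T\ell_t(\theta_t)\le C\sqrt T\left(\sqrt{(m+1)\log N+m\log T}+V^{(m+1)}(\boldsymbol\theta_T)\right),$$ where $$V^{(m+1)}(\boldsymbol\theta_T):=\min_{t_2,\dots,t_{m+1}}\ \sum_{k=1}^{m+1}\ \min_{i_k\in\{1,\dots,N\}}\ \sum_{t=t_k}^{t_{k+1}-1}\|\theta_{t+1}-\Phi_{i_k,t}(\theta_t)\|,$$ the outer minimum being over integers with $1=t_1<t_2<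\dots<t_{m+1}<t_{m+2}=T$.
   Context: Setting. $\Theta\subset\mathbb{R}^d$ is closed, bounded, convex. At each time $t$ the loss is $\ell_t=f_t+r$, with $f_t,r:\Theta\to\mathbb{R}$ convex and $r$ not depending on $t$. Subgradients exist at all points of $\Theta$; $\nabla f_t(\theta),\nabla r(\theta)$ denote (arbitrarily chosen) subgradients and $\nabla\ell_t=\nabla f_t+\nabla r$. Standing assumptions. $\|\cdot\|$ is a norm on $\mathbb{R}^d$ with dual norm $\|\cdot\|_*$. $\psi:\Theta\to\mathbb{R}$ is continuously differentiable and $\sigma$-strongly convex ($\sigma>0$) with respect to $\|\cdot\|$: $\psi(\theta_1)\ge\psi(\theta_2)+\langle\nabla\psi(\theta_2),\theta_1-\theta_2\rangle+\frac\sigma2\|\theta_1-\theta_2\|^2$. The Bregman divergence is $D(\theta_1\|\theta_2)=\psi(\theta_1)-\psi(\theta_2)-\langle\nabla\psi(\theta_2),\theta_1-\theta_2\rangle$. For all $t$ and $\theta\in\Theta$: $\|\nabla\ell_t(\theta)\|_*\le G$ and $\|\nabla\psi(\theta)\|_*\le M$. For all $\theta_1,\theta_2\in\Theta$: $D(\theta_1\|\theta_2)\le D_{\max}$. The constants $\sigma,G,M,D_{\max}$ do not depend on $T$. DFS algorithm. Parameters: step sizes $\eta_t>0$, $\eta_r>0$, and $\lambda\in(0,1)$. Initialize $\widehat\theta_1\in\Theta$, $\widehat\theta_{i,1}\in\Theta$, $w_{i,1}=1/N$ for $i=1,\dots,N$. For $t=1,\dots,T$: the loss $\ell_t(\widehat\theta_t)$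 is incurred, and for each $i$ set $$\widetilde w_{i,t+1}=\frac{w_{i,t}\exp(-\eta_r\ell_t(\widehat\theta_{i,t}))}{\sum_{j=1}^N w_{j,t}\exp(-\eta_r\ell_t(\widehat\theta_{j,t}))},\qquad w_{i,t+1}=\frac\lambda N+(1-\lambda)\widetilde w_{i,t+1},$$ $$\widetilde\theta_{i,t+1}=\arg\min_{\theta\in\Theta}\ \eta_t\langle\nabla f_t(\widehat\theta_{i,t}),\theta\rangle+\eta_t r(\theta)+D(\theta\|\widehat\theta_{i,t}),\qquad \widehat\theta_{i,t+1}=\Phi_{i,t}(\widetilde\theta_{i,t+1});$$ then $\widehat\theta_{t+1}=\sum_{i=1}^N w_{i,t+1}\widehat\theta_{i,t+1}$. *)

(* Defs.v *)
From HB Require Import structures.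
From mathcomp Require Import all_boot all_order all_algebra.
From mathcomp Require Import all_classical all_reals all_analysis.

Set Implicit Arguments.
Unset Strict Implicit.
Unset Printing Implicit Defensive.

Import Order.TTheory GRing.Theory Num.Theory.
Import numFieldNormedType.Exports.

Local Open Scope classical_set_scope.
Local Open Scope ring_scope.

(* Functions on Theta are total functions on 'rV[R]_d; only their restriction
   to Theta is ever used.  Sequences are indexed by nat, and only the indices
   1 <= t <= T (T.+1 for the last update) are relevant. *)

Definition dotv (R : realType) (d : nat) (x y : 'rV[R]_d) : R :=
  \sum_(i < d) x ord0 i * y ord0 i.

Record is_norm (R : realType) (d : nat) (nrm : 'rV[R]_d -> R) : Prop := IsNorm {
  is_norm_triangle : forall x y, nrm (x + y) <= nrm x + nrm y ;
  is_norm_scale : forall (a : R) x, nrm (a *: x) = `|a| * nrm x ;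
  is_norm_definite : forall x, nrm x = 0 -> x = 0
}.

(* An extended-real supremum, so that a bound on it carries its meaning even
   before one knows that the supremum is finite. *)
Definition dual_norm (R : realType) (d : nat) (nrm : 'rV[R]_d -> R)
    (g : 'rV[R]_d) : \bar R :=
  ereal_sup [set (dotv g x)%:E | x in [set x | nrm x <= 1]].

Definition is_subgradient (R : realType) (d : nat) (Theta : set 'rV[R]_d)
    (f : 'rV[R]_d -> R) (x g : 'rV[R]_d) : Prop :=
  forall y, Theta y -> f x + dotv g (y - x) <= f y.

(* Theta may have empty interior, so differentiability is relative to Theta,
   with respect to a chosen gradient field gpsi (which need not be unique if
   the affine hull of Theta is not the whole space).  `|.| is the sup norm of
   'rV[R]_d; all norms define the same notion. *)
Definition C1_on (R : realType) (d : nat) (Theta : set 'rV[R]_d)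
    (psi : 'rV[R]_d -> R) (gpsi : 'rV[R]_d -> 'rV[R]_d) : Prop :=
  (forall x, Theta x -> forall eps : R, 0 < eps ->
     \forall y \near within Theta (nbhs x),
       `|psi y - psi x - dotv (gpsi x) (y - x)| <= eps * `|y - x|) /\
  {within Theta, continuous gpsi}.

Definition strongly_convex_on (R : realType) (d : nat) (Theta : set 'rV[R]_d)
    (nrm : 'rV[R]_d -> R) (sigma : R)
    (psi : 'rV[R]_d -> R) (gpsi : 'rV[R]_d -> 'rV[R]_d) : Prop :=
  forall x y, Theta x -> Theta y ->
    psi y + dotv (gpsi y) (x - y) + sigma / 2 * nrm (x - y) ^+ 2 <= psi x.

Definition bregman (R : realType) (d : nat)
    (psi : 'rV[R]_d -> R) (gpsi : 'rV[R]_d -> 'rV[R]_d) (x y : 'rV[R]_d) : R :=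
  psi x - psi y - dotv (gpsi y) (x - y).

Definition is_argmin (R : realType) (d : nat) (Theta : set 'rV[R]_d)
    (h : 'rV[R]_d -> R) (x : 'rV[R]_d) : Prop :=
  Theta x /\ forall y, Theta y -> h x <= h y.

(* [dfs_pred t] is the prediction played at time t and [dfs_exp i t] the
   iterate of expert i.  [gf t x] is the chosen subgradient of [f t] at [x]. *)
Record is_DFS_run (R : realType) (d N T : nat) (Theta : set 'rV[R]_d)
    (psi : 'rV[R]_d -> R) (gpsi : 'rV[R]_d -> 'rV[R]_d)
    (f : nat -> 'rV[R]_d -> R) (gf : nat -> 'rV[R]_d -> 'rV[R]_d)
    (r : 'rV[R]_d -> R) (Phi : 'I_N -> nat -> 'rV[R]_d -> 'rV[R]_d)
    (lambda eta_r : R) (eta : nat -> R)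
    (dfs_pred : nat -> 'rV[R]_d) (dfs_exp dfs_exp_tilde : 'I_N -> nat -> 'rV[R]_d)
    (w wtilde : 'I_N -> nat -> R) : Prop := IsDFSRun {
  dfs_pred_init : Theta (dfs_pred 1%N) ;
  dfs_exp_init : forall i, Theta (dfs_exp i 1%N) ;
  dfs_w_init : forall i, w i 1%N = N%:R^-1 ;
  dfs_wtilde_step : forall i t, (1 <= t <= T)%N ->
    wtilde i t.+1 =
      w i t * expR (- eta_r * (f t (dfs_exp i t) + r (dfs_exp i t))) /
      \sum_(j < N) w j t * expR (- eta_r * (f t (dfs_exp j t) + r (dfs_exp j t))) ;
  dfs_w_step : forall i t, (1 <= t <= T)%N ->
    w i t.+1 = lambda / N%:R + (1 - lambda) * wtilde i t.+1 ;
  dfs_exp_tilde_step : forall i t, (1 <= t <= T)%N ->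
    is_argmin Theta
      (fun x => eta t * dotv (gf t (dfs_exp i t)) x + eta t * r x
                + bregman psi gpsi x (dfs_exp i t))
      (dfs_exp_tilde i t.+1) ;
  dfs_exp_step : forall i t, (1 <= t <= T)%N ->
    dfs_exp i t.+1 = Phi i t (dfs_exp_tilde i t.+1) ;
  dfs_pred_step : forall t, (1 <= t <= T)%N ->
    dfs_pred t.+1 = \sum_(i < N) w i t.+1 *: dfs_exp i t.+1
}.

(* 1 = tau_1 < tau_2 < ... < tau_{m+1} < tau_{m+2} = T *)
Definition switch_times (m T : nat) (tau : nat -> nat) : Prop :=
  [/\ tau 1%N = 1%N, tau m.+2 = T &
      forall k, (1 <= k <= m.+1)%N -> (tau k < tau k.+1)%N].

(* Both infima are over finite sets, nonempty as soon as 0 < N and m + 2 <= T,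
   so they are the minima of these sets. *)
Definition switching_variation (R : realType) (d N : nat)
    (nrm : 'rV[R]_d -> R) (Phi : 'I_N -> nat -> 'rV[R]_d -> 'rV[R]_d)
    (m T : nat) (theta : nat -> 'rV[R]_d) : R :=
  inf [set \sum_(1 <= k < m.+2)
             inf [set \sum_(tau k <= t < tau k.+1)
                        nrm (theta t.+1 - Phi i t (theta t)) | i in [set: 'I_N]]
      | tau in switch_times m T].

(* Main.v *)
(* Writing [D] for the Bregman divergence, the regret on a segment of time
   between two switches splits, for any expert [i], into the regret of the
   weighted mixture against expert [i] and the regret of expert [i] against the
   comparator.

   For the former, an update multiplies [w i t] by
   [exp (- eta_r * loss) / normalization] up to a factor at least [1 - lam], so
   Hoeffding's lemma makes the per-step regret a difference of [ln (w i t)], up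
   to errors.  These telescope over a segment, and since every weight is at
   least [lam / N] at all times, each segment costs at most [ln (N / lam)].

   For the latter, optimality of the proximal step and contractivity of the
   model give the mirror descent inequality with
   [D (theta t.+1) _ - D (Phi i t (theta t)) _ <= 2 * M * nrm _] as the price of
   a comparator that does not follow the model.

   The bound holds for every segmentation and every choice of experts, hence
   for the minimum defining the variation. *)
Require Import Defs.
From HB Require Import structures.
From mathcomp Require Import all_boot all_order all_algebra.
From mathcomp Require Import all_classical all_reals all_analysis.
From mathcomp Require Import ring lra.

Set Implicit Arguments.
Unset Strict Implicit.
Unset Printing Implicit Defensive.

Import Order.TTheory GRing.Theory Num.Theory.
Import numFieldNormedType.Exports.

Local Open Scope classical_set_scope.
Local Open Scope ring_scope.

(** * The pairing [dotv] and its linearity *)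

Section InnerProduct.
Context (R : realType) (d : nat).
Implicit Types x y z : 'rV[R]_d.

Lemma dotvDr x y z : dotv x (y + z) = dotv x y + dotv x z.
Proof. by rewrite /dotv -big_split; apply: eq_bigr => i _; rewrite !mxE mulrDr. Qed.

Lemma dotvDl x y z : dotv (x + y) z = dotv x z + dotv y z.
Proof. by rewrite /dotv -big_split; apply: eq_bigr => i _; rewrite !mxE mulrDl. Qed.

Lemma dotvZr (a : R) x y : dotv x (a *: y) = a * dotv x y.
Proof. by rewrite /dotv mulr_sumr; apply: eq_bigr => i _; rewrite !mxE mulrCA. Qed.

Lemma dotvNr x y : dotv x (- y) = - dotv x y.
Proof. by rewrite -scaleN1r dotvZr mulN1r. Qed.

Lemma dotvBr x y z : dotv x (y - z) = dotv x y - dotv x z.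
Proof. by rewrite dotvDr dotvNr. Qed.

Lemma dotv0r x : dotv x 0 = 0.
Proof. by rewrite -(scale0r 0) dotvZr mul0r. Qed.

Lemma dotv_sumr x (I : Type) (s : seq I) (F : I -> 'rV[R]_d) :
  dotv x (\sum_(i <- s) F i) = \sum_(i <- s) dotv x (F i).
Proof. exact: (big_morph _ (dotvDr x) (dotv0r x)). Qed.

End InnerProduct.

(** * Norms and dual norms *)

Section Norm.
Context (R : realType) (d : nat) (nrm : 'rV[R]_d -> R).
Hypothesis nrmP : is_norm nrm.

Lemma is_norm0 : nrm 0 = 0.
Proof. by rewrite -(scale0r 0) (is_norm_scale nrmP) normr0 mul0r. Qed.

Lemma is_normN x : nrm (- x) = nrm x.
Proof. by rewrite -scaleN1r (is_norm_scale nrmP) normrN normr1 mul1r. Qed.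

Lemma is_norm_ge0 x : 0 <= nrm x.
Proof.
have := is_norm_triangle nrmP x (- x); rewrite subrr is_norm0 is_normN.
by rewrite -mulr2n pmulrn_lge0.
Qed.

(** The zero vector lies in the unit ball. The signs of [G] and [M], which are not assumed, are
    recovered this way from any point of [Theta]. *)
Lemma dual_norm_ge0 (K : R) g : (dual_norm nrm g <= K%:E)%E -> 0 <= K.
Proof.
move=> gK; rewrite -lee_fin; apply: le_trans gK.
by apply: ereal_sup_ubound; exists 0; rewrite /= ?is_norm0// dotv0r.
Qed.

Lemma dotv_le_dual_norm (K : R) g x :
  (dual_norm nrm g <= K%:E)%E -> dotv g x <= K * nrm x.
Proof.
move=> gK; have [x0|x0] := eqVneq (nrm x) 0.
  by rewrite (is_norm_definite nrmP x0) is_norm0 mulr0 dotv0r.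
have xgt0 : 0 < nrm x by rewrite lt_neqAle eq_sym x0 is_norm_ge0.
rewrite -ler_pdivrMr// mulrC -dotvZr -lee_fin; apply: le_trans gK.
apply: ereal_sup_ubound; exists ((nrm x)^-1 *: x) => //=.
by rewrite (is_norm_scale nrmP) gtr0_norm ?invr_gt0// mulVf.
Qed.

End Norm.

(** * Convex combinations in a convex set *)

Lemma convex_setP (R : realType) (E : lmodType R) (A : set E) (x y : E) (p : R) :
  convex_set A -> A x -> A y -> 0 <= p <= 1 -> A (p *: x + (1 - p) *: y).
Proof.
move=> cvxA Ax Ay /andP[p0 p1].
by have := cvxA x y (Itv01 p0 p1); rewrite !inE => /(_ Ax Ay).
Qed.

(* Stated with normalized sums so that the induction on the list goes through. *)
Lemma convex_set_barycenter (R : realType) (E : lmodType R) (A : set E)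
    (I : Type) (w : I -> R) (x : I -> E) (i : I) (s : seq I) :
  convex_set A -> (forall j, 0 < w j) -> (forall j, A (x j)) ->
  A ((\sum_(j <- i :: s) w j)^-1 *: \sum_(j <- i :: s) w j *: x j).
Proof.
move=> cvxA w0 xA; elim: s i => [|j s IH] i.
  by rewrite !big_seq1 scalerA mulVf ?scale1r ?gt_eqF.
have S0 : 0 < \sum_(k <- j :: s) w k.
  by rewrite big_cons ltr_pwDl// sumr_ge0// => k _; rewrite ltW.
have := IH j; rewrite [in \sum_(_ <- [:: i, j & s]) w _]big_cons.
rewrite [\sum_(_ <- [:: i, j & s]) (_ *: _)]big_cons.
set S := \sum_(k <- j :: s) w k in S0 *.
set P := \sum_(k <- j :: s) w k *: x k => PA.
have wS : 0 < w i + S by rewrite addr_gt0.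
have p01 : 0 <= w i / (w i + S) <= 1.
  rewrite ler_pdivrMr// mul1r lerDl (ltW S0) andbT.
  by rewrite divr_ge0// ltW.
have := convex_setP cvxA (xA i) PA p01; congr A.
rewrite scalerDr !scalerA [w i / _]mulrC; congr (_ + _ *: _).
by field; rewrite !gt_eqF.
Qed.

Lemma convex_set_sum (R : realType) (E : lmodType R) (A : set E) (n : nat)
    (w : 'I_n -> R) (x : 'I_n -> E) :
  convex_set A -> (forall i, 0 < w i) -> (forall i, A (x i)) ->
  \sum_i w i = 1 -> A (\sum_i w i *: x i).
Proof.
move=> cvxA w0 xA; rewrite /index_enum; case: (Finite.enum _) => [|i s] w1.
  (* Over an empty index set the weights would sum to 0, not 1. *)
  by move: w1; rewrite big_nil => /esym/eqP; rewrite oner_eq0.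
by have := convex_set_barycenter i s cvxA w0 xA; rewrite w1 invr1 scale1r.
Qed.

(** * Exponential moments of a variable of bounded range *)

(* Below [1/2] use [expR x <= 1 / (1 - x) <= 1 + x + 2 * x ^+ 2]; above, [x <= 2 * x ^+ 2]. *)
Lemma expR_le_DexpR_sqr (R : realType) (x : R) : expR x <= x + expR (2 * x ^+ 2).
Proof.
have [x2|x2] := leP x 2^-1; last first.
  have : expR x <= expR (2 * x ^+ 2) by rewrite ler_expR; nra.
  lra.
have e1 := expR_ge1Dx (- x); have e2 := expR_ge1Dx (2 * x ^+ 2).
have e0 := expR_gt0 x; rewrite expRN in e1.
have : expR x * (1 - x) <= 1.
  by rewrite -[leRHS](mulfV (lt0r_neq0 e0)) ler_wpM2l// ltW.
nra.
Qed.

(* Hoeffding's lemma with [2] in place of the sharp constant [1/8]. *)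
Lemma sum_expR_le (R : realType) (n : nat) (w X : 'I_n -> R) (b eta : R) :
  (forall i, 0 <= w i) -> \sum_i w i = 1 -> (forall i j, X i - X j <= b) ->
  \sum_i w i * expR (- eta * X i)
    <= expR (- eta * (\sum_i w i * X i) + 2 * (eta * b) ^+ 2).
Proof.
move=> w0 w1 Xb; set m := \sum_i w i * X i.
have mE c : \sum_i w i * (X i - c) = m - c.
  under eq_bigr do rewrite mulrBr.
  by rewrite sumrB -mulr_suml w1 mul1r.
(* Averaging [X i - X j <= b] over either index puts the mean within [b] of every value. *)
have Xm i : (X i - m) ^+ 2 <= b ^+ 2.
  have h1 : X i - m <= b.
    rewrite -opprB -mE -sumrN -[leRHS]mul1r -w1 mulr_suml ler_sum// => j _.
    by rewrite -mulrN opprB ler_wpM2l.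
  have h2 : m - X i <= b.
    by rewrite -mE -[leRHS]mul1r -w1 mulr_suml ler_sum// => j _; rewrite ler_wpM2l.
  by nra.
have -> : \sum_i w i * expR (- eta * X i)
    = expR (- eta * m) * \sum_i w i * expR (- eta * (X i - m)).
  rewrite mulr_sumr; apply: eq_bigr => i _.
  by rewrite mulrCA -expRD; congr (_ * expR _); ring.
rewrite expRD ler_wpM2l ?expR_ge0//.
(* After centering, the linear terms of [expR_le_DexpR_sqr] average to 0 and only the quadratic
   exponent survives. *)
apply: (@le_trans _ _ (\sum_i (- eta * (w i * (X i - m))
                          + w i * expR (2 * (eta * b) ^+ 2)))).
  apply: ler_sum => i _; rewrite mulrCA -mulrDr ler_wpM2l//.
  apply: le_trans (expR_le_DexpR_sqr _) _; rewrite lerD2l ler_expR.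
  by rewrite !exprMn sqrrN ler_pM2l// ler_wpM2l// sqr_ge0.
by rewrite big_split/= -mulr_sumr mE subrr mulr0 add0r -mulr_suml w1 mul1r.
Qed.

(** * Fixed share: weights, and regret against one expert on a segment *)

Section FixedShare.
Context (R : realType) (N T : nat) (L w wt : 'I_N -> nat -> R) (lam eta b : R).
Hypotheses (N0 : (0 < N)%N) (eta0 : 0 < eta) (lam01 : 0 < lam < 1).
Hypothesis Lb : forall t i j, (1 <= t <= T)%N -> L i t - L j t <= b.
Hypothesis w_init : forall i, w i 1%N = N%:R^-1.
Hypothesis wt_step : forall i t, (1 <= t <= T)%N ->
  wt i t.+1 = w i t * expR (- eta * L i t) / \sum_j w j t * expR (- eta * L j t).
Hypothesis w_step : forall i t, (1 <= t <= T)%N ->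
  w i t.+1 = lam / N%:R + (1 - lam) * wt i t.+1.

Let lam0 : 0 < lam. Proof. by case/andP: lam01. Qed.
Let lamC0 : 0 < 1 - lam. Proof. by case/andP: lam01; rewrite subr_gt0. Qed.
Let NR0 : 0 < N%:R :> R. Proof. by rewrite ltr0n. Qed.

Lemma fixed_share_weights t : (1 <= t <= T.+1)%N ->
  (forall i, 0 < w i t) /\ \sum_i w i t = 1.
Proof.
elim: t => // -[_ _|t IH tT].
  split=> [i|]; first by rewrite w_init invr_gt0.
  under eq_bigr do rewrite w_init.
  by rewrite sumr_const card_ord -[_ *+ _]mulr_natl mulfV ?gt_eqF.
have tT' : (1 <= t.+1 <= T)%N by [].
have [w0 w1] := IH (ltnW tT).
have Z0 : 0 < \sum_j w j t.+1 * expR (- eta * L j t.+1).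
  rewrite (bigD1 (Ordinal N0))//= ltr_pwDl ?mulr_gt0 ?expR_gt0//.
  by rewrite sumr_ge0// => j _; rewrite mulr_ge0 ?expR_ge0// ltW.
split=> [i|].
  rewrite w_step// wt_step// addr_gt0 ?divr_gt0// mulr_gt0// divr_gt0//.
  by rewrite mulr_gt0 ?expR_gt0.
under eq_bigr do rewrite w_step// wt_step//.
rewrite big_split/= sumr_const card_ord -mulr_sumr -mulr_suml mulfV ?gt_eqF//.
by rewrite -[_ *+ _]mulr_natl; field; rewrite gt_eqF.
Qed.

Lemma fixed_share_lower_bound i t : (1 <= t <= T.+1)%N -> lam / N%:R <= w i t.
Proof.
case: t => // -[_|t tT].
  by rewrite w_init ler_pdivrMr// mulVf ?gt_eqF//; case/andP: lam01 => _ /ltW.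
have tT' : (1 <= t.+1 <= T)%N by [].
have [w0 _] := fixed_share_weights (ltnW tT : (1 <= t.+1 <= T.+1)%N).
rewrite w_step// lerDl; apply: mulr_ge0; first exact: ltW.
rewrite wt_step// divr_ge0//.
  by rewrite mulr_ge0 ?expR_ge0// ltW.
by rewrite sumr_ge0// => j _; rewrite mulr_ge0 ?expR_ge0// ltW.
Qed.

Lemma fixed_share_le1 i t : (1 <= t <= T.+1)%N -> w i t <= 1.
Proof.
move=> /fixed_share_weights[w0 <-]; rewrite (bigD1 i)//= lerDl.
by rewrite sumr_ge0// => j _; exact: ltW.
Qed.

(** The normalization [Z] satisfies [ln Z <= - eta * m + 2 * (eta * b) ^+ 2] by the exponential
    moment bound. Since [ln (wt i t.+1)] is [ln (w i t) - eta * L i t - ln Z] and mixing shrinks a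
    weight by at most the factor [1 - lam], solving for [m - L i t] gives the claim. *)
Lemma fixed_share_step i t : (1 <= t <= T)%N ->
  \sum_j w j t * L j t - L i t
  <= (ln (w i t.+1) - ln (w i t) - ln (1 - lam)) / eta + 2 * eta * b ^+ 2.
Proof.
move=> tT; have tT1 : (1 <= t <= T.+1)%N by case/andP: tT => -> /leqW.
have [w0 w1] := fixed_share_weights tT1.
set m := \sum_j w j t * L j t.
have := sum_expR_le eta (fun j => ltW (w0 j)) w1 (fun i j => Lb i j tT).
rewrite -/m; set Z := \sum_i w i t * _ => Zle.
have wi0 := w0 i; have eL := expR_gt0 (- eta * L i t).
have Z0 : 0 < Z.
  rewrite /Z (bigD1 i)//= ltr_pwDl ?mulr_gt0//.
  by rewrite sumr_ge0// => j _; rewrite mulr_ge0 ?expR_ge0// ltW.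
have wti0 : 0 < wt i t.+1 by rewrite wt_step// divr_gt0 ?mulr_gt0.
have lnZ : ln Z <= - eta * m + 2 * (eta * b) ^+ 2.
  by rewrite -[leRHS]expRK ler_ln// posrE ?expR_gt0.
have lnwt : ln (wt i t.+1) = ln (w i t) - eta * L i t - ln Z.
  rewrite wt_step// ln_div ?posrE ?mulr_gt0// lnM ?posrE//.
  by rewrite expRK mulNr.
have lnw : ln (1 - lam) + ln (wt i t.+1) <= ln (w i t.+1).
  rewrite -lnM ?posrE// ler_ln ?posrE ?mulr_gt0//.
    by rewrite w_step// lerDr divr_ge0 ?ltW.
  by rewrite w_step// addr_gt0 ?divr_gt0// mulr_gt0.
rewrite -lerBlDr ler_pdivlMr//; rewrite lnwt in lnw.
by rewrite exprMn in lnZ; nra.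
Qed.

(** The per-step errors are nonnegative, so the segment length is enlarged to [T]; the bound then
    serves every segment alike. The telescoped part costs at most [ln (N%:R / lam)], as weights lie
    between [lam / N%:R] and 1. *)
Lemma fixed_share_segment i s e : (1 <= s)%N -> (s < e)%N -> (e <= T)%N ->
  \sum_(s <= t < e) (\sum_j w j t * L j t - L i t)
  <= (ln (N%:R / lam) - T%:R * ln (1 - lam)) / eta + T%:R * (2 * eta * b ^+ 2).
Proof.
move=> s1 se eT.
have sT : (1 <= s <= T.+1)%N by rewrite s1 (leq_trans (ltnW se))// leqW.
have eT1 : (1 <= e <= T.+1)%N by rewrite (leq_trans s1 (ltnW se)) leqW.
have step t : (s <= t < e)%N -> \sum_j w j t * L j t - L i t <=
    (ln (w i t.+1) / eta - ln (w i t) / eta)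
      + (- ln (1 - lam) / eta + 2 * eta * b ^+ 2).
  move=> /andP[st te]; have tT : (1 <= t <= T)%N.
    by rewrite (leq_trans s1 st) (leq_trans (ltnW te)).
  by apply: le_trans (fixed_share_step i tT) _; rewrite addrA -!mulrBl -mulrDl.
apply: le_trans (ler_sum_nat step) _.
rewrite big_split/= telescope_sumr 1?ltnW// sumr_const_nat -mulrBl -[_ *+ _]mulr_natl.
have c0 : 0 <= - ln (1 - lam) / eta + 2 * eta * b ^+ 2.
  rewrite addr_ge0//; last by rewrite mulr_ge0 ?sqr_ge0// mulr_ge0// ltW.
  by rewrite divr_ge0 ?oppr_ge0 ?ln_le0 ?(ltW eta0)// lerBlDr lerDl ltW.
have eTs : (e - s)%:R <= T%:R :> R by rewrite ler_nat leq_subLR (leq_trans eT)// leq_addl.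
apply: le_trans (lerD (lexx _) (ler_wpM2r c0 eTs)) _.
rewrite mulrDr addrA lerD2r [leRHS]mulrBl lerD//; last by rewrite mulrA mulrN mulNr.
rewrite ler_pM2r ?invr_gt0//.
have w0 := (fixed_share_weights sT).1 i.
have -> : ln (N%:R / lam) = - ln (lam / N%:R) by rewrite -lnV ?posrE ?divr_gt0// invf_div.
have h1 : ln (lam / N%:R) <= ln (w i s).
  by rewrite ler_ln ?posrE ?divr_gt0// fixed_share_lower_bound.
have h2 : ln (w i e) <= 0 by rewrite ln_le0// fixed_share_le1.
lra.
Qed.

End FixedShare.

(** * Mirror descent with a proximal step *)

Lemma bregman_three_points (R : realType) (d : nat) (psi : 'rV[R]_d -> R)
    (gpsi : 'rV[R]_d -> 'rV[R]_d) (x y z : 'rV[R]_d) :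
  bregman psi gpsi y x - bregman psi gpsi y z - bregman psi gpsi z x
  = dotv (gpsi z) (y - z) - dotv (gpsi x) (y - z).
Proof. by rewrite /bregman !dotvBr; ring. Qed.

Section MirrorDescent.
Context (R : realType) (d : nat) (Theta : set 'rV[R]_d) (nrm : 'rV[R]_d -> R).
Context (psi : 'rV[R]_d -> R) (gpsi : 'rV[R]_d -> 'rV[R]_d).
Context (sigma G M Dmax : R).
Hypotheses (Theta_convex : convex_set Theta) (nrm_norm : is_norm nrm).
Hypothesis psi_C1 : C1_on Theta psi gpsi.
Hypothesis sigma_gt0 : 0 < sigma.
Hypothesis psi_strongly_convex : strongly_convex_on Theta nrm sigma psi gpsi.
Hypothesis gpsi_bounded :
  forall x, Theta x -> (dual_norm nrm (gpsi x) <= M%:E)%E.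
Hypothesis bregman_bounded : forall x y, Theta x -> Theta y ->
  bregman psi gpsi x y <= Dmax.
Implicit Types x y z g : 'rV[R]_d.

Local Notation D := (bregman psi gpsi).

Lemma bregman_ge_sqr x y : Theta x -> Theta y ->
  sigma / 2 * nrm (x - y) ^+ 2 <= D x y.
Proof.
by move=> xT yT; have := psi_strongly_convex xT yT; rewrite /bregman; lra.
Qed.

Lemma bregman_ge0 x y : Theta x -> Theta y -> 0 <= D x y.
Proof.
move=> xT yT; apply: le_trans (bregman_ge_sqr xT yT).
by rewrite mulr_ge0 ?sqr_ge0// divr_ge0// ltW.
Qed.

(** Strong convexity turns the bound on the divergence into a bound on the diameter, which later
    controls the range of the losses. *)
Lemma nrm_sub_le x y : Theta x -> Theta y ->
  nrm (x - y) <= Num.sqrt (2 * Dmax / sigma).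
Proof.
move=> xT yT; rewrite -[leLHS]ger0_norm ?is_norm_ge0// -sqrtr_sqr ler_wsqrtr//.
rewrite ler_pdivlMr//.
by have := bregman_ge_sqr xT yT; have := bregman_bounded xT yT; lra.
Qed.

(** Nonnegativity of [D z y] gives [psi y - psi z <= dotv (gpsi y) (y - z)]. What remains pairs
    [y - z] with two gradients of dual norm at most [M]. *)
Lemma bregman_sub_le x y z : Theta x -> Theta y -> Theta z ->
  D y x - D z x <= 2 * M * nrm (y - z).
Proof.
move=> xT yT zT; have := bregman_ge0 zT yT.
have := dotv_le_dual_norm nrm_norm (y - z) (gpsi_bounded yT).
have := dotv_le_dual_norm nrm_norm (z - y) (gpsi_bounded xT).
have -> : nrm (z - y) = nrm (y - z) by rewrite -opprB is_normN.
by rewrite /bregman !dotvBr; lra.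
Qed.

(* First-order condition, from comparing [z] with [z + s *: (y - z)] as [s]
   goes to 0; no subgradient of [r] at [z] appears. *)
Lemma prox_optimality (r : 'rV[R]_d -> R) (gr : 'rV[R]_d -> 'rV[R]_d)
    (eta : R) g x y z :
  (forall v, Theta v -> is_subgradient Theta r v (gr v)) ->
  0 < eta -> Theta y ->
  is_argmin Theta (fun v => eta * dotv g v + eta * r v + D v x) z ->
  eta * (dotv g z + r z)
  <= eta * (dotv g y + r y) + (dotv (gpsi z) (y - z) - dotv (gpsi x) (y - z)).
Proof.
move=> rsub eta0 yT [zT zmin]; apply/ler_addgt0Pr => eps eps0.
(* Adding 1 to the distance, here and through [de] in the choice of [s], avoids a case distinction
   on [y = z]. *)
have n1 : 0 < `|y - z| + 1 by rewrite ltr_wpDl.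
have e1 : 0 < eps / (`|y - z| + 1) by rewrite divr_gt0.
have /nbhs_ballP[de /= de0 near_z] := psi_C1.1 _ zT _ e1.
have dn : 0 < de + `|y - z| by rewrite ltr_wpDr.
(* This [s] is at most 1 and moves [z] by less than [de]. *)
pose s := de / (de + `|y - z|).
have s0 : 0 < s by rewrite divr_gt0.
have s1 : s <= 1 by rewrite ler_pdivrMr// mul1r lerDl.
pose v := s *: y + (1 - s) *: z.
have vT : Theta v by apply: convex_setP => //; rewrite s1 ltW.
have vz : v - z = s *: (y - z).
  by rewrite /v scalerBl scale1r addrA addrAC addrK -scalerBr.
have vball : ball z de v.
  rewrite -ball_normE /= distrC vz normrZ gtr0_norm// mulrAC ltr_pdivrMr//.
  by rewrite ltr_pM2l// ltrDr.
have := near_z v vball vT; rewrite /= vz dotvZr normrZ (gtr0_norm s0).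
move=> /(le_trans (ler_norm _)) psiv.
have ey : eps / (`|y - z| + 1) * `|y - z| <= eps.
  by rewrite mulrAC ler_pdivrMr// ler_pM2l// lerDl.
have r1 := rsub v vT y yT; have r2 := rsub v vT z zT.
(* Convexity of [r] along the segment, from the subgradient at [v]: the weighted displacements to
   the two endpoints cancel. *)
have rv : r v <= s * r y + (1 - s) * r z.
  have e0 : s * dotv (gr v) (y - v) + (1 - s) * dotv (gr v) (z - v) = 0.
    by rewrite !dotvBr /v !dotvDr !dotvZr; ring.
  have s1' : 0 <= 1 - s by rewrite subr_ge0.
  have := lerD (ler_wpM2l (ltW s0) r1) (ler_wpM2l s1' r2); lra.
have := zmin v vT; have -> : D v x = D z x + psi v - psi z - s * dotv (gpsi x) (y - z).
  by rewrite /bregman -dotvZr -vz !dotvBr; ring.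
have -> : dotv g v = dotv g z + s * (dotv g y - dotv g z).
  by rewrite /v dotvDr !dotvZr; ring.
move=> hmin; rewrite -subr_ge0 -(pmulr_rge0 _ s0).
have erv := ler_wpM2l (ltW eta0) rv.
have sey := ler_wpM2l (ltW s0) ey.
rewrite mulrCA in psiv; move: psiv sey.
set X := eps / _ * _ => psiv sey.
nra.
Qed.

(** The first-order condition and the three-point identity leave [D y x - D y z - D z x]. The
    subgradient of [r] at [x] bounds [r x - r z], so the full gradient [g + gr x] is paired with
    [x - z]; the resulting [eta * (G * n)] is absorbed by the quadratic lower bound on [D z x]. *)
Lemma prox_step (f r : 'rV[R]_d -> R) (gr : 'rV[R]_d -> 'rV[R]_d)
    (eta : R) g x y z :
  (forall v, Theta v -> is_subgradient Theta r v (gr v)) ->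
  is_subgradient Theta f x g -> (dual_norm nrm (g + gr x) <= G%:E)%E ->
  0 < eta -> Theta x -> Theta y ->
  is_argmin Theta (fun v => eta * dotv g v + eta * r v + D v x) z ->
  f x + r x - (f y + r y) <= (D y x - D y z) / eta + G ^+ 2 / (2 * sigma) * eta.
Proof.
move=> rsub fsub gG eta0 xT yT zmin; have zT := zmin.1.
have opt := prox_optimality rsub eta0 yT zmin.
have tp := bregman_three_points psi gpsi x y z.
have sc := bregman_ge_sqr zT xT.
have fy := fsub y yT; have rz := rsub x xT z zT.
have := dotv_le_dual_norm nrm_norm (x - z) gG.
have -> : nrm (x - z) = nrm (z - x) by rewrite -opprB is_normN.
set n := nrm _ in sc *; rewrite dotvDl => gn.
have key : eta * (f x + r x - (f y + r y))
    <= D y x - D y z + (eta * (G * n) - sigma / 2 * n ^+ 2).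
  rewrite !dotvBr in fy rz gn.
  have := ler_wpM2l (ltW eta0) fy; have := ler_wpM2l (ltW eta0) rz.
  have := ler_wpM2l (ltW eta0) gn; lra.
have amgm : eta * (G * n) - sigma / 2 * n ^+ 2 <= G ^+ 2 / (2 * sigma) * eta * eta.
  rewrite -subr_ge0.
  (* Completing the square in [sigma * n]. *)
  have -> : G ^+ 2 / (2 * sigma) * eta * eta - (eta * (G * n) - sigma / 2 * n ^+ 2)
    = (eta * G - sigma * n) ^+ 2 / (2 * sigma) by field; rewrite gt_eqF.
  by rewrite divr_ge0 ?sqr_ge0// mulr_ge0// ltW.
rewrite -(ler_pM2l eta0); apply: le_trans key _.
have -> : eta * ((D y x - D y z) / eta + G ^+ 2 / (2 * sigma) * eta) =
  D y x - D y z + G ^+ 2 / (2 * sigma) * eta * eta by field; rewrite !gt_eqF.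
by rewrite lerD2l.
Qed.

(** * Tracking a moving comparator through a contractive model *)

Section Tracking.
Context (T : nat) (f : nat -> 'rV[R]_d -> R) (r : 'rV[R]_d -> R).
Context (gf : nat -> 'rV[R]_d -> 'rV[R]_d) (gr : 'rV[R]_d -> 'rV[R]_d).
Context (Phi : nat -> 'rV[R]_d -> 'rV[R]_d) (eta : nat -> R).
Context (xh xt theta : nat -> 'rV[R]_d).
Hypothesis f_subgradient : forall t x, (1 <= t <= T)%N -> Theta x ->
  is_subgradient Theta (f t) x (gf t x).
Hypothesis r_subgradient :
  forall x, Theta x -> is_subgradient Theta r x (gr x).
Hypothesis G_bounded : forall t x, (1 <= t <= T)%N -> Theta x ->
  (dual_norm nrm (gf t x + gr x) <= G%:E)%E.
Hypothesis Phi_stable : forall t x, (1 <= t <= T)%N -> Theta x -> Theta (Phi t x).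
Hypothesis Phi_contractive : forall t x y, (1 <= t <= T)%N ->
  Theta x -> Theta y -> D (Phi t x) (Phi t y) <= D x y.
Hypothesis eta_gt0 : forall t, (1 <= t <= T)%N -> 0 < eta t.
Hypothesis eta_nincr :
  forall s t, (1 <= s)%N -> (s <= t)%N -> (t <= T)%N -> eta t <= eta s.
Hypothesis xh_init : Theta (xh 1%N).
Hypothesis xt_step : forall t, (1 <= t <= T)%N ->
  is_argmin Theta
    (fun x => eta t * dotv (gf t (xh t)) x + eta t * r x + D x (xh t)) (xt t.+1).
Hypothesis xh_step : forall t, (1 <= t <= T)%N -> xh t.+1 = Phi t (xt t.+1).
Hypothesis theta_in : forall t, (1 <= t <= T)%N -> Theta (theta t).

Lemma mirror_iterate_in t : (1 <= t <= T.+1)%N -> Theta (xh t).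
Proof.
case: t => // -[//|t] tT; have tT' : (1 <= t.+1 <= T)%N by [].
by rewrite xh_step//; apply: Phi_stable => //; exact: (xt_step tT').1.
Qed.

Lemma mirror_tracking s e : (1 <= s)%N -> (s < e)%N -> (e <= T)%N ->
  \sum_(s <= t < e) (f t (xh t) + r (xh t) - (f t (theta t) + r (theta t)))
  <= Dmax / eta T + G ^+ 2 / (2 * sigma) * (\sum_(1 <= t < T.+1) eta t)
     + 2 * M / eta T * (\sum_(s <= t < e) nrm (theta t.+1 - Phi t (theta t))).
Proof.
move=> s1 se eT.
have T1 : (1 <= T <= T)%N by rewrite leqnn andbT (leq_trans s1)// (leq_trans (ltnW se)).
have M0 : 0 <= M := dual_norm_ge0 nrm_norm (gpsi_bounded xh_init).
(* Potential for summation by parts: as [1 / eta] is nondecreasing, [u] grows by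
   at least [(D (theta t) (xh t) - D (theta t.+1) (xh t.+1)) / eta t]. *)
pose u t := (Dmax - D (theta t) (xh t)) / eta t.
have step t : (s <= t < e)%N ->
    f t (xh t) + r (xh t) - (f t (theta t) + r (theta t))
    <= (u t.+1 - u t) + (G ^+ 2 / (2 * sigma) * eta t
         + 2 * M / eta T * nrm (theta t.+1 - Phi t (theta t))).
  move=> /andP[st te].
  have t1 : (1 <= t)%N := leq_trans s1 st.
  have tT : (t < T)%N := leq_trans te eT.
  have tT1 : (1 <= t <= T)%N by rewrite t1 ltnW.
  have tT2 : (1 <= t.+1 <= T)%N by [].
  have tT3 : (1 <= t <= T.+1)%N by rewrite t1 leqW// ltnW.
  have xhT := mirror_iterate_in tT3.
  have xhT' := mirror_iterate_in (ltnW tT : (1 <= t.+1 <= T.+1)%N).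
  have thT := theta_in tT1; have thT' := theta_in tT2.
  have ps := prox_step r_subgradient (f_subgradient tT1 xhT) (G_bounded tT1 xhT)
    (eta_gt0 tT1) xhT thT (xt_step tT1).
  have xtT := (xt_step tT1).1.
  have contr := Phi_contractive tT1 thT xtT; rewrite -xh_step// in contr.
  have shift := bregman_sub_le xhT' thT' (Phi_stable tT1 thT).
  have D1 := bregman_bounded thT' xhT'.
  set n := nrm _ in shift *.
  have n0 : 0 <= n by exact: is_norm_ge0.
  have a0 : 0 < (eta t)^-1 by rewrite invr_gt0 eta_gt0.
  have a1 : (eta t)^-1 <= (eta t.+1)^-1.
    by rewrite lef_pV2 ?posrE ?eta_gt0// eta_nincr.
  have a2 : (eta t)^-1 <= (eta T)^-1.
    by rewrite lef_pV2 ?posrE ?eta_gt0// eta_nincr// ltnW.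
  suff : (D (theta t) (xh t) - D (theta t) (xt t.+1)) / eta t
      <= (u t.+1 - u t) + 2 * M / eta T * n by lra.
  (* Contractivity replaces [theta t] and [xt t.+1] by their images under [Phi t], the second being
     [xh t.+1]; [shift] then trades [Phi t (theta t)] for [theta t.+1]. *)
  have h1 : D (theta t) (xh t) - D (theta t) (xt t.+1)
     <= (D (theta t) (xh t) - D (theta t.+1) (xh t.+1)) + 2 * M * n by lra.
  apply: le_trans (ler_wpM2r (ltW a0) h1) _.
  rewrite mulrDl lerD//.
    have : 0 <= (Dmax - D (theta t.+1) (xh t.+1)) * ((eta t.+1)^-1 - (eta t)^-1).
      by rewrite mulr_ge0// subr_ge0.
    by rewrite /u; lra.
  by rewrite mulrAC ler_wpM2r// ler_wpM2l// mulr_ge0.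
apply: le_trans (ler_sum_nat step) _.
rewrite big_split/= telescope_sumr 1?ltnW// big_split/= -!mulr_sumr addrA lerD2r.
have eT1 : (1 <= e <= T)%N by rewrite (leq_trans s1 (ltnW se)).
have sT1 : (1 <= s <= T)%N by rewrite s1 (leq_trans (ltnW se)).
(* The telescoped difference [u e - u s] is thus at most [Dmax / eta T], whatever the segment. *)
have ub t : (1 <= t <= T)%N -> 0 <= u t <= Dmax / eta T.
  move=> tT; have /andP[t1 tT'] := tT.
  have tT3 : (1 <= t <= T.+1)%N by rewrite t1 leqW.
  have D0 := bregman_ge0 (theta_in tT) (mirror_iterate_in tT3).
  have D1 := bregman_bounded (theta_in tT) (mirror_iterate_in tT3).
  rewrite /u divr_ge0 ?subr_ge0 ?(ltW (eta_gt0 tT))//=.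
  have a2 : (eta t)^-1 <= (eta T)^-1.
    by rewrite lef_pV2 ?posrE ?eta_gt0// eta_nincr.
  apply: (@le_trans _ _ (Dmax / eta t)).
    by rewrite ler_pM2r ?invr_gt0 ?eta_gt0// lerBlDr lerDl.
  by rewrite ler_wpM2l// (le_trans D0).
apply: lerD.
  by have /andP[_ ?] := ub e eT1; have /andP[? _] := ub s sT1; lra.
rewrite ler_wpM2l ?divr_ge0 ?sqr_ge0 ?mulr_ge0 ?(ltW sigma_gt0)//.
(* Positive step sizes allow the sum to be enlarged from the segment to all times up to [T]. *)
rewrite [leRHS](@big_cat_nat _ _ _ s)//=; last by rewrite leqW// (leq_trans (ltnW se)).
rewrite (@big_cat_nat _ _ _ e s T.+1)//= ?(ltnW se) ?leqW//.
have nn a b : (1 <= a)%N -> (b <= T.+1)%N -> 0 <= \sum_(a <= t < b) eta t.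
  move=> a1 bT; rewrite big_nat sumr_ge0// => t /andP[at_ tb].
  by rewrite ltW// eta_gt0// (leq_trans a1 at_) -ltnS (leq_trans tb).
have := nn 1%N s isT (leqW (ltnW (leq_trans se eT))).
have := nn e T.+1 (leq_trans s1 (ltnW se)) (leqnn _).
lra.
Qed.

End Tracking.
End MirrorDescent.

(** * Segmentations and the variation of the comparator *)

Section Switching.
Context (m T : nat) (tau : nat -> nat).
Hypothesis tauP : switch_times m T tau.

Lemma switch_times_le j k :
  (1 <= j)%N -> (j <= k)%N -> (k <= m.+2)%N -> (tau j <= tau k)%N.
Proof.
case: tauP => _ _ tault j1; elim: k => [|k IH]; first by case: j j1.
rewrite leq_eqVlt => /predU1P[-> //|jk km].
apply: leq_trans (IH jk (ltnW km)) _; apply/ltnW/tault.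
by rewrite (leq_trans j1 jk).
Qed.

Lemma sum_switch_times (R : realType) (g : nat -> R) :
  \sum_(1 <= k < m.+2) \sum_(tau k <= t < tau k.+1) g t = \sum_(1 <= t < T) g t.
Proof.
case: tauP => tau1 tauT tault; rewrite -tauT.
suff sumE j : (j <= m.+1)%N -> \sum_(1 <= k < j.+1)
    \sum_(tau k <= t < tau k.+1) g t = \sum_(1 <= t < tau j.+1) g t.
  exact: sumE.
elim: j => [_|j IH jm]; first by rewrite tau1 !big_geq.
rewrite big_nat_recr//= IH 1?ltnW// -big_cat_nat//=.
  by rewrite -{1}tau1 switch_times_le// ltnW.
by rewrite ltnW// tault.
Qed.

End Switching.

(** Makes the outer set of the variation nonempty, without which its [inf] would be a default value.
    The witness switches at each of the first times and then jumps to [T]. *)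
Lemma switch_times_exists (m T : nat) : (m.+1 < T)%N -> exists tau, switch_times m T tau.
Proof.
move=> mT; exists (fun k => if k == m.+2 then T else k).
split => [//||k /andP[_ km]]; first by rewrite eqxx.
by rewrite ltn_eqF ?ltnS//; case: ifP => // _; exact: leq_ltn_trans mT.
Qed.

(** Solving for the variation, which requires [0 < alpha], reduces the claim to a lower bound on the
    outer set, and then, segment by segment, on the inner sets. *)
Lemma le_switching_variation (R : realType) (d N : nat) (nrm : 'rV[R]_d -> R)
    (Phi : 'I_N -> nat -> 'rV[R]_d -> 'rV[R]_d) (m T : nat)
    (theta : nat -> 'rV[R]_d) (g : nat -> R) (A alpha : R) :
  (0 < N)%N -> (m.+1 < T)%N -> 0 < alpha ->
  (forall i s e, (1 <= s)%N -> (s < e)%N -> (e <= T)%N ->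
     \sum_(s <= t < e) g t <= A + alpha *
       \sum_(s <= t < e) nrm (theta t.+1 - Phi i t (theta t))) ->
  \sum_(1 <= t < T) g t
  <= m.+1%:R * A + alpha * switching_variation nrm Phi m T theta.
Proof.
move=> N0 mT alpha0 seg.
rewrite -lerBlDl -ler_pdivrMl// /switching_variation; apply: lb_le_inf.
  by have [tau tauP] := switch_times_exists mT; eexists; exists tau.
move=> _ [tau tauP <-]; rewrite ler_pdivrMl// lerBlDl -(sum_switch_times tauP).
have -> : m.+1%:R * A = \sum_(1 <= k < m.+2) A.
  by rewrite sumr_const_nat subSS subn0 mulr_natl.
rewrite mulr_sumr -big_split/=; apply: ler_sum_nat => k /andP[k1 km].
rewrite -lerBlDl -ler_pdivrMl//; apply: lb_le_inf.
  by eexists; exists (Ordinal N0).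
move=> _ [i _ <-]; rewrite ler_pdivrMl// lerBlDl.
have [tau1 tauT tault] := tauP.
apply: seg; last by rewrite -[leqRHS]tauT; exact: (switch_times_le tauP).
  by rewrite -[leqLHS]tau1; apply: (switch_times_le tauP) => //; exact: ltnW.
by apply: tault; rewrite k1.
Qed.

(** * Sums of step sizes and tuning of the parameters *)

Lemma sum_inv_sqrt_le (R : realType) (T : nat) :
  \sum_(1 <= t < T.+1) (Num.sqrt t%:R)^-1 <= 2 * Num.sqrt T%:R :> R.
Proof.
elim: T => [|T IH]; first by rewrite big_geq// mulr_ge0// sqrtr_ge0.
rewrite big_nat_recr//=; apply: le_trans (lerD IH (lexx _)) _.
have b0 : 0 < Num.sqrt T.+1%:R :> R by rewrite sqrtr_gt0 ltr0n.
have a0 : 0 <= Num.sqrt T%:R :> R by rewrite sqrtr_ge0.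
have ba : Num.sqrt T.+1%:R ^+ 2 = Num.sqrt T%:R ^+ 2 + 1 :> R.
  by rewrite !sqr_sqrtr// natr1.
(* With [b] and [a] the roots of [T.+1] and [T], the claim [1 <= 2 * (b - a) * b] is
   [(b - a) ^+ 2 >= 0] combined with [b ^+ 2 = a ^+ 2 + 1]. *)
by rewrite -lerBrDl -[leLHS]mul1r ler_pdivrMr//; nra.
Qed.

Lemma ler_sqr_le (R : realDomainType) (x y : R) : 0 <= y -> x ^+ 2 <= y ^+ 2 -> x <= y.
Proof. by move=> y0 xy; rewrite leNgt; apply/negP => ltyx; nra. Qed.

Section Tuning.
Context (R : realType) (N m T : nat) (lam eta : R).
Hypotheses (N0 : (0 < N)%N) (lam01 : 0 < lam < 1).
Hypothesis lamE : lam = m%:R / (T%:R - 1).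
Let K : R := m.+1%:R * ln N%:R + m%:R * ln T%:R.
Hypothesis etaE : eta = Num.sqrt (8 * (K + 1) / T%:R).

Lemma switches_gt0 : (0 < m)%N.
Proof.
rewrite lt0n; apply/eqP => m0; case/andP: lam01.
by rewrite lamE m0 mul0r ltxx.
Qed.

Lemma switches_lt : (m.+1 < T)%N.
Proof.
have m0 := switches_gt0; case/andP: lam01; rewrite lamE => l0 l1.
(* The subtraction is real: [T = 0] would make [lam] negative, and [T = 1] would make it 0 by the
   convention on division. *)
have T1 : 0 < T%:R - 1 :> R.
  by move: l0; rewrite pmulr_rgt0 ?ltr0n// invr_gt0.
by move: l1; rewrite ltr_pdivrMr// mul1r ltrBrDr natr1 ltr_nat.
Qed.

Let TR0 : 0 < T%:R :> R.
Proof. by rewrite ltr0n (leq_trans _ switches_lt). Qed.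

Lemma ln_card_ge0 : 0 <= ln N%:R :> R.
Proof. by rewrite ln_ge0// ler1n. Qed.

(** Apply [ln x <= x - 1] at [x = T%:R^-1], with [T] at least 2. *)
Lemma ln_horizon_ge : 1 / 2 <= ln T%:R :> R.
Proof.
have T2 : 2 <= T%:R :> R by rewrite ler_nat (leq_trans _ switches_lt).
have Tv : T%:R^-1 <= 2^-1 :> R by rewrite lef_pV2 ?posrE.
have Tv0 : 0 < T%:R^-1 :> R by rewrite invr_gt0.
have : -1 < T%:R^-1 - 1 :> R by lra.
by move=> /le_ln1Dx; rewrite addrC subrK lnV ?posrE//; lra.
Qed.

(** Keeps [K] away from 0 uniformly in [T], so that additive constants can be absorbed into
    multiples of [K]. *)
Lemma complexity_ge : 1 / 2 <= K.
Proof.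
have := ln_horizon_ge; have l0 := ln_card_ge0.
have m1 : 1 <= m%:R :> R by rewrite ler1n switches_gt0.
have := mulr_ge0 (ler0n R m.+1) l0; rewrite /K; nra.
Qed.

(** Here [1 / lam = (T - 1) / m <= T] handles the first logarithm. For the second, [- ln (1 - lam)
    <= 1 / (1 - lam) - 1 = m / (T - 1 - m)], and [T <= (m + 2) * (T - 1 - m)] because
    [T >= m + 2]. *)
Lemma mixing_cost_le :
  ln (N%:R / lam) - T%:R * ln (1 - lam) <= m.+1%:R ^+ 2 * (K + 1).
Proof.
have [lam0 lam1] := andP lam01; have mT := switches_lt.
have K2 := complexity_ge; have m1 : 1 <= m%:R :> R by rewrite ler1n switches_gt0.
have NR0 : 0 < N%:R :> R by rewrite ltr0n.
have gap : m%:R + 2 <= T%:R :> R by rewrite -natrD ler_nat addn2.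
have lnlam : - ln lam <= ln T%:R.
  rewrite -lnV ?posrE// ler_ln ?posrE ?invr_gt0// lamE invf_div.
  by rewrite ler_pdivrMr; nra.
have e1 : ln (N%:R / lam) <= K.
  rewrite ln_div ?posrE// /K -natr1.
  have l1 := ln_card_ge0; have l2 := ln_horizon_ge; nra.
have e2 : - (T%:R * ln (1 - lam)) <= m%:R * (m%:R + 2).
  have v1 : 1 <= (1 - lam)^-1 by rewrite invf_ge1 ?subr_gt0// lerBlDr lerDl ltW.
  have /le_ln1Dx : -1 < (1 - lam)^-1 - 1 by lra.
  rewrite addrC subrK lnV ?posrE ?subr_gt0// => h.
  rewrite -mulrN; apply: le_trans (ler_wpM2l (ltW TR0) h) _.
  have g0 : 0 < T%:R - 1 - m%:R :> R by lra.
  have -> : (1 - lam)^-1 - 1 = m%:R / (T%:R - 1 - m%:R).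
    by rewrite lamE; field; apply/andP; split; lra.
  by rewrite mulrA ler_pdivrMr//; nra.
by rewrite -natr1; nra.
Qed.

Lemma learning_rate_gt0 : 0 < eta.
Proof.
have := complexity_ge => K2.
by rewrite etaE sqrtr_gt0 divr_gt0// mulr_gt0//; lra.
Qed.

Let eta_sqr : eta ^+ 2 * T%:R = 8 * (K + 1).
Proof.
have := complexity_ge => K2; rewrite etaE sqr_sqrtr ?divfK ?gt_eqF//.
by rewrite divr_ge0 ?ltW// mulr_gt0//; lra.
Qed.

Let sT := Num.sqrt (T%:R : R).
Let sK := Num.sqrt K.
Let sT_sqr : sT ^+ 2 = T%:R. Proof. by rewrite sqr_sqrtr// ltW. Qed.
Let sK_sqr : sK ^+ 2 = K.
Proof. by rewrite sqr_sqrtr//; have := complexity_ge; lra. Qed.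
Let sT0 : 0 <= sT. Proof. exact: sqrtr_ge0. Qed.
Let sK0 : 0 <= sK. Proof. exact: sqrtr_ge0. Qed.

Lemma sqrt_complexity_ge : 1 <= 2 * sK.
Proof.
have K2 := complexity_ge; have s2 := sK_sqr; have s0 := sK0.
by rewrite leNgt; apply/negP => lt1; nra.
Qed.

Lemma mixing_regret_le :
  (ln (N%:R / lam) - T%:R * ln (1 - lam)) / eta
  <= 2 * m.+1%:R ^+ 2 * sK * sT.
Proof.
have e0 := learning_rate_gt0; have K2 := complexity_ge.
rewrite ler_pdivrMr//; apply: le_trans mixing_cost_le _.
have -> : 2 * m.+1%:R ^+ 2 * sK * sT * eta = m.+1%:R ^+ 2 * (2 * sK * sT * eta).
  by ring.
(* Comparing squares, this is [(K + 1) ^+ 2 <= 32 * K * (K + 1)]. *)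
rewrite ler_wpM2l ?sqr_ge0// ler_sqr_le ?mulr_ge0// 1?ltW//.
have -> : (2 * sK * sT * eta) ^+ 2 = 4 * sK ^+ 2 * (eta ^+ 2 * sT ^+ 2) by ring.
by rewrite sT_sqr eta_sqr sK_sqr; nra.
Qed.

Lemma variance_regret_le (b : R) :
  T%:R * (2 * eta * b ^+ 2) <= 12 * b ^+ 2 * sK * sT.
Proof.
have e0 := learning_rate_gt0; have K2 := complexity_ge.
(* After squaring, the constant 6 comes from [8 * (K + 1) <= 36 * K], valid for [K >= 1 / 2]. *)
have h : T%:R * eta <= 6 * sK * sT.
  apply: ler_sqr_le; first by rewrite !mulr_ge0.
  have -> : (T%:R * eta) ^+ 2 = T%:R * (eta ^+ 2 * T%:R) by ring.
  have -> : (6 * sK * sT) ^+ 2 = sT ^+ 2 * (36 * sK ^+ 2) by ring.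
  by rewrite sT_sqr eta_sqr sK_sqr ler_wpM2l//; lra.
have := ler_wpM2l (sqr_ge0 b) h; lra.
Qed.

End Tuning.

(** * Regret of the combined algorithm *)

Section Regret.
Context (R : realType) (d : nat) (Theta : set 'rV[R]_d) (nrm : 'rV[R]_d -> R).
Context (psi : 'rV[R]_d -> R) (gpsi : 'rV[R]_d -> 'rV[R]_d).
Context (sigma G M Dmax : R).
Hypotheses (Theta_convex : convex_set Theta) (nrm_norm : is_norm nrm).
Hypothesis psi_C1 : C1_on Theta psi gpsi.
Hypothesis sigma_gt0 : 0 < sigma.
Hypothesis psi_strongly_convex : strongly_convex_on Theta nrm sigma psi gpsi.
Hypothesis gpsi_bounded :
  forall x, Theta x -> (dual_norm nrm (gpsi x) <= M%:E)%E.
Hypothesis bregman_bounded : forall x y, Theta x -> Theta y ->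
  bregman psi gpsi x y <= Dmax.
Context (N m T : nat) (f : nat -> 'rV[R]_d -> R) (r : 'rV[R]_d -> R).
Context (gf : nat -> 'rV[R]_d -> 'rV[R]_d) (gr : 'rV[R]_d -> 'rV[R]_d).
Context (Phi : 'I_N -> nat -> 'rV[R]_d -> 'rV[R]_d) (lam eta_r : R) (eta : nat -> R).
Context (xp : nat -> 'rV[R]_d) (xe xt : 'I_N -> nat -> 'rV[R]_d).
Context (w wt : 'I_N -> nat -> R) (theta : nat -> 'rV[R]_d).
Hypotheses (N0 : (0 < N)%N) (mT : (m.+1 < T)%N).
Hypothesis f_subgradient : forall t x, (1 <= t <= T)%N -> Theta x ->
  is_subgradient Theta (f t) x (gf t x).
Hypothesis r_subgradient :
  forall x, Theta x -> is_subgradient Theta r x (gr x).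
Hypothesis G_bounded : forall t x, (1 <= t <= T)%N -> Theta x ->
  (dual_norm nrm (gf t x + gr x) <= G%:E)%E.
Hypothesis Phi_stable :
  forall i t x, (1 <= t <= T)%N -> Theta x -> Theta (Phi i t x).
Hypothesis Phi_contractive : forall i t x y, (1 <= t <= T)%N ->
  Theta x -> Theta y ->
  bregman psi gpsi (Phi i t x) (Phi i t y) <= bregman psi gpsi x y.
Hypotheses (lam01 : 0 < lam < 1) (eta_r_gt0 : 0 < eta_r).
Hypothesis eta_gt0 : forall t, (1 <= t <= T)%N -> 0 < eta t.
Hypothesis eta_nincr :
  forall s t, (1 <= s)%N -> (s <= t)%N -> (t <= T)%N -> eta t <= eta s.
Hypothesis run :
  is_DFS_run T Theta psi gpsi f gf r Phi lam eta_r eta xp xe xt w wt.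
Hypothesis theta_in : forall t, (1 <= t <= T)%N -> Theta (theta t).

Let ell t x := f t x + r x.
(** Gradient bound times diameter bound: the oscillation of each loss over [Theta]. Only differences
    of losses are controlled, not their values. *)
Let b := G * Num.sqrt (2 * Dmax / sigma).

Lemma loss_subgradient t x y : (1 <= t <= T)%N -> Theta x -> Theta y ->
  ell t x + dotv (gf t x + gr x) (y - x) <= ell t y.
Proof.
move=> tT xT yT; rewrite dotvDl /ell.
have := f_subgradient tT xT yT; have := r_subgradient xT yT; lra.
Qed.

Lemma loss_range t x y : (1 <= t <= T)%N -> Theta x -> Theta y ->
  ell t x - ell t y <= b.
Proof.
move=> tT xT yT; have h := loss_subgradient tT xT yT.
have gG := G_bounded tT xT.
have h1 := dotv_le_dual_norm nrm_norm (x - y) gG.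
have h2 := ler_wpM2l (dual_norm_ge0 nrm_norm gG)
  (nrm_sub_le nrm_norm sigma_gt0 psi_strongly_convex bregman_bounded xT yT).
rewrite -/b in h2; rewrite !dotvBr in h h1; lra.
Qed.

Lemma dfs_expert_in i t : (1 <= t <= T.+1)%N -> Theta (xe i t).
Proof.
apply: (mirror_iterate_in (psi := psi) (gpsi := gpsi) (r := r) (gf := gf)
  (Phi := Phi i) (eta := eta) (xh := xe i) (xt := xt i)) => //.
- by move=> s x; exact: Phi_stable.
- exact: (dfs_exp_init run).
- by move=> s; exact: (dfs_exp_tilde_step run).
- by move=> s; exact: (dfs_exp_step run).
Qed.

Let L i t := ell t (xe i t).

Let L_range t i j : (1 <= t <= T)%N -> L i t - L j t <= b.
Proof.
move=> tT; have tT1 : (1 <= t <= T.+1)%N by case/andP: tT => -> /leqW.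
by apply: loss_range => //; exact: dfs_expert_in.
Qed.

Let weights t : (1 <= t <= T.+1)%N -> (forall i, 0 < w i t) /\ \sum_i w i t = 1.
Proof.
exact: (fixed_share_weights N0 lam01 (dfs_w_init run)
  (dfs_wtilde_step run : forall i t, _ -> wt i t.+1 =
     w i t * expR (- eta_r * L i t) / \sum_j w j t * expR (- eta_r * L j t))
  (dfs_w_step run)).
Qed.

Lemma dfs_pred_in t : (1 <= t <= T.+1)%N -> Theta (xp t).
Proof.
case: t => // -[_|t tT]; first exact: (dfs_pred_init run).
rewrite (dfs_pred_step run)//; have [w0 w1] := weights tT.
by apply: convex_set_sum => // i; exact: dfs_expert_in.
Qed.

(** Jensen's inequality through the subgradient at [xp t]: the linear terms average to 0 because
    [xp t] is the weighted mean of the experts, which is guaranteed only from time 2 on. *)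
Lemma dfs_pred_loss_le t : (1 < t <= T)%N ->
  ell t (xp t) <= \sum_i w i t * L i t.
Proof.
case: t => // -[//|t] tT; have tT1 : (1 <= t.+2 <= T)%N by [].
have tT2 : (1 <= t.+2 <= T.+1)%N by exact: leqW.
have [w0 w1] := weights tT2; have xpT := dfs_pred_in tT2.
have : \sum_i w i t.+2 * (ell t.+2 (xp t.+2)
    + dotv (gf t.+2 (xp t.+2) + gr (xp t.+2)) (xe i t.+2 - xp t.+2))
    <= \sum_i w i t.+2 * L i t.+2.
  apply: ler_sum => i _; rewrite ler_wpM2l ?(ltW (w0 i))//.
  by apply: loss_subgradient => //; exact: dfs_expert_in.
apply: le_trans; under eq_bigr do rewrite mulrDr -dotvZr.
rewrite big_split/= -mulr_suml w1 mul1r -dotv_sumr.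
under [in dotv _ _]eq_bigr do rewrite scalerBr.
rewrite sumrB -scaler_suml w1 scale1r.
have -> : \sum_i w i t.+2 *: xe i t.+2 = xp t.+2 by rewrite (dfs_pred_step run)// ltnW.
by rewrite subrr dotv0r addr0.
Qed.

(** The slack in [alpha] keeps it positive even when [M] is 0. The term [2 * b] pays for the first
    prediction and for time [T]. *)
Lemma dfs_regret (alpha : R) : 0 < alpha -> 2 * M / eta T <= alpha ->
  \sum_(1 <= t < T.+1) ell t (xp t) - \sum_(1 <= t < T.+1) ell t (theta t)
  <= 2 * b
     + m.+1%:R * ((ln (N%:R / lam) - T%:R * ln (1 - lam)) / eta_r
                  + T%:R * (2 * eta_r * b ^+ 2)
                  + (Dmax / eta T
                     + G ^+ 2 / (2 * sigma) * (\sum_(1 <= t < T.+1) eta t)))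
     + alpha * switching_variation nrm Phi m T theta.
Proof.
move=> alpha0 Malpha; set A := (_ / eta_r + _ + _).
have T1 : (1 < T)%N by exact: leq_trans mT.
pose g t := \sum_i w i t * L i t - ell t (theta t).
have main : \sum_(1 <= t < T) g t
    <= m.+1%:R * A + alpha * switching_variation nrm Phi m T theta.
  apply: le_switching_variation => // i s e s1 se eT.
  have fs := fixed_share_segment N0 eta_r_gt0 lam01 L_range (dfs_w_init run)
    (dfs_wtilde_step run : forall i t, _ -> wt i t.+1 =
       w i t * expR (- eta_r * L i t) / \sum_j w j t * expR (- eta_r * L j t))
    (dfs_w_step run) i s1 se eT.
  have mt := mirror_tracking Theta_convex nrm_norm psi_C1 sigma_gt0
    psi_strongly_convex gpsi_bounded bregman_bounded f_subgradient r_subgradient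
    G_bounded (Phi_stable i) (Phi_contractive i) eta_gt0 eta_nincr
    (dfs_exp_init run i) (dfs_exp_tilde_step run i) (dfs_exp_step run i)
    theta_in s1 se eT.
  have -> : \sum_(s <= t < e) g t = \sum_(s <= t < e) (\sum_j w j t * L j t - L i t)
      + \sum_(s <= t < e) (L i t - ell t (theta t)).
    by rewrite -big_split/=; apply: eq_bigr => t _; rewrite /g addrA subrK.
  have S0 : 0 <= \sum_(s <= t < e) nrm (theta t.+1 - Phi i t (theta t)).
    by apply: sumr_ge0 => t _; exact: is_norm_ge0.
  have MS := ler_wpM2r S0 Malpha.
  by apply: le_trans (lerD fs mt) _; rewrite addrA lerD2l.
have [w0 w1] := weights (isT : (1 <= 1 <= T.+1)%N).
(* [xp 1] is arbitrary in [Theta], not the weighted mean of the experts. *)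
have first_step : ell 1%N (xp 1%N) - \sum_i w i 1%N * L i 1%N <= b.
  rewrite -[ell _ _]mul1r -[leRHS]mul1r -{1 2}w1 !mulr_suml -sumrB.
  apply: ler_sum => i _; rewrite -mulrBr ler_wpM2l ?(ltW (w0 i))//.
  by apply: loss_range; [exact: ltnW|exact: dfs_pred_in|exact: dfs_expert_in].
(* The segments cover only the times before [T], so time [T] is bounded by the range of the loss. *)
have last_step : ell T (xp T) - ell T (theta T) <= b.
  have TT : (1 <= T <= T)%N by rewrite leqnn ltnW.
  apply: loss_range => //; last exact: theta_in.
  by apply: dfs_pred_in; rewrite leqnSn ltnW.
(* Only time 1 contributes; the later terms are nonpositive. *)
have body : \sum_(1 <= t < T) (ell t (xp t) - \sum_i w i t * L i t) <= b.
  rewrite big_ltn// -[leRHS]addr0 lerD// big_nat sumr_le0// => t /andP[t1 tT].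
  by rewrite subr_le0 dfs_pred_loss_le// t1 ltnW.
rewrite -sumrB big_nat_recr/=; last exact: ltnW.
have -> : \sum_(1 <= t < T) (ell t (xp t) - ell t (theta t)) =
    \sum_(1 <= t < T) (ell t (xp t) - \sum_i w i t * L i t) + \sum_(1 <= t < T) g t.
  by rewrite -big_split/=; apply: eq_bigr => t _; rewrite /g addrA subrK.
lra.
Qed.

End Regret.

Theorem theorem3 (R : realType) (d : nat) (Theta : set 'rV[R]_d)
    (nrm : 'rV[R]_d -> R)
    (psi : 'rV[R]_d -> R) (gpsi : 'rV[R]_d -> 'rV[R]_d)
    (sigma G M Dmax c : R) (N m : nat)
    (Theta_closed : closed Theta) (Theta_bounded : bounded_set Theta)
    (Theta_convex : convex_set Theta)
    (nrm_norm : is_norm nrm)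
    (psi_C1 : C1_on Theta psi gpsi)
    (sigma_gt0 : 0 < sigma)
    (psi_strongly_convex : strongly_convex_on Theta nrm sigma psi gpsi)
    (gpsi_bounded : forall x, Theta x -> (dual_norm nrm (gpsi x) <= M%:E)%E)
    (bregman_bounded : forall x y, Theta x -> Theta y ->
       bregman psi gpsi x y <= Dmax)
    (c_gt0 : 0 < c) (N_gt0 : (0 < N)%N) :
  exists C : R, 0 < C /\
  forall (T : nat)
    (f : nat -> 'rV[R]_d -> R) (r : 'rV[R]_d -> R)
    (gf : nat -> 'rV[R]_d -> 'rV[R]_d) (gr : 'rV[R]_d -> 'rV[R]_d)
    (Phi : 'I_N -> nat -> 'rV[R]_d -> 'rV[R]_d)
    (lambda eta_r : R) (eta : nat -> R)
    (dfs_pred : nat -> 'rV[R]_d) (dfs_exp dfs_exp_tilde : 'I_N -> nat -> 'rV[R]_d)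
    (w wtilde : 'I_N -> nat -> R),
  (forall t, (1 <= t <= T)%N -> convex_function Theta (f t)) ->
  convex_function Theta r ->
  (forall t, (1 <= t <= T)%N ->
     [lipschitz (f t x + r x : R^o) | x in Theta]) ->
  (forall t x, (1 <= t <= T)%N -> Theta x ->
     is_subgradient Theta (f t) x (gf t x)) ->
  (forall x, Theta x -> is_subgradient Theta r x (gr x)) ->
  (forall t x, (1 <= t <= T)%N -> Theta x ->
     (dual_norm nrm (gf t x + gr x) <= G%:E)%E) ->
  (forall i t x, (1 <= t <= T)%N -> Theta x -> Theta (Phi i t x)) ->
  (forall i t x y, (1 <= t <= T)%N -> Theta x -> Theta y ->
     bregman psi gpsi (Phi i t x) (Phi i t y) <= bregman psi gpsi x y) ->
  lambda = m%:R / (T%:R - 1) -> 0 < lambda < 1 ->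
  eta_r = Num.sqrt (8 * (m.+1%:R * ln N%:R + m%:R * ln T%:R + 1) / T%:R) ->
  ((forall t, (1 <= t <= T)%N -> eta t = c / Num.sqrt t%:R) \/
   (forall t, (1 <= t <= T)%N -> eta t = c / Num.sqrt T%:R)) ->
  is_DFS_run T Theta psi gpsi f gf r Phi lambda eta_r eta
    dfs_pred dfs_exp dfs_exp_tilde w wtilde ->
  forall theta : nat -> 'rV[R]_d,
  (forall t, (1 <= t <= T)%N -> Theta (theta t)) ->
  \sum_(1 <= t < T.+1) (f t (dfs_pred t) + r (dfs_pred t))
    - \sum_(1 <= t < T.+1) (f t (theta t) + r (theta t))
  <= C * Num.sqrt T%:R *
     (Num.sqrt (m.+1%:R * ln N%:R + m%:R * ln T%:R)
      + switching_variation nrm Phi m T theta).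
Proof.
(* Absolute values appear because the constant is chosen before any run supplies a point of [Theta],
   hence before the signs of [G], [M] and [Dmax] are known. *)
pose b : R := `|G| * Num.sqrt (2 * Dmax / sigma).
pose C0 : R := 4 * b + m.+1%:R * (2 * m.+1%:R ^+ 2 + 12 * b ^+ 2
  + (2 * `|Dmax| / c + 4 * (G ^+ 2 / (2 * sigma)) * c)).
have b0 : 0 <= b by rewrite mulr_ge0// sqrtr_ge0.
have G0 : 0 <= G ^+ 2 / (2 * sigma).
  by rewrite divr_ge0 ?sqr_ge0// mulr_ge0// ltW.
have D0 : 0 <= `|Dmax| / c by rewrite divr_ge0// ltW.
have M0 : 0 <= `|M| / c by rewrite divr_ge0// ltW.
have C00 : 0 <= C0.
  have Gc := mulr_ge0 G0 (ltW c_gt0).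
  have b2 := sqr_ge0 b; have m2 := sqr_ge0 (m.+1%:R : R).
  by apply: addr_ge0; [lra|apply: mulr_ge0 => //; lra].
(* [C0] collects everything but the variation, whose coefficient [2 * M / eta T] accounts for the
   second term; the 1 ensures positivity. *)
exists (C0 + 2 * (`|M| / c) + 1); split; first by lra.
move=> T f r gf gr Phi lam eta_r eta xp xe xt w wt _ _ _ f_sub r_sub G_bnd
  Phi_in Phi_contr lamE lam01 eta_rE etaE run theta theta_in.
have mT := switches_lt lam01 lamE.
have TT : (1 <= T <= T)%N by rewrite leqnn (leq_trans _ mT).
have T0 : 0 < T%:R :> R by rewrite ltr0n; case/andP: TT.
have x1T : Theta (xp 1%N) := dfs_pred_init run.
have Mabs : `|M| = M by rewrite ger0_norm// (dual_norm_ge0 nrm_norm (gpsi_bounded _ x1T)).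
have Gabs : `|G| = G.
  by rewrite ger0_norm// (dual_norm_ge0 nrm_norm (G_bnd T _ TT x1T)).
set sT := Num.sqrt T%:R; set sK := Num.sqrt (_ + _).
have sT1 : 1 <= sT by rewrite -sqrtr1 ler_wsqrtr// ler1n; case/andP: TT.
have sK1 : 1 <= 2 * sK := sqrt_complexity_ge N_gt0 lam01 lamE.
have eta_gt0 t : (1 <= t <= T)%N -> 0 < eta t.
  move=> tT; have /andP[t1 _] := tT.
  by case: etaE => -> //; rewrite divr_gt0// sqrtr_gt0//; rewrite ltr0n.
have eta_nincr s t : (1 <= s)%N -> (s <= t)%N -> (t <= T)%N -> eta t <= eta s.
  move=> s1 st tT; have sT' : (1 <= s <= T)%N by rewrite s1 (leq_trans st).
  have t1 := leq_trans s1 st; have tT' : (1 <= t <= T)%N by rewrite t1.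
  case: etaE => etaE; rewrite !etaE// ler_pM2l// lef_pV2 ?posrE ?sqrtr_gt0 ?ltr0n//.
  by rewrite ler_wsqrtr// ler_nat.
have etaT : (eta T)^-1 = sT / c.
  by case: etaE => ->//; rewrite invf_div.
have sum_eta : \sum_(1 <= t < T.+1) eta t <= 2 * c * sT.
  case: etaE => etaE.
    rewrite (eq_big_nat _ _ (F2 := fun t => c * (Num.sqrt t%:R)^-1)); last first.
      by move=> t; exact: etaE.
    rewrite -mulr_sumr.
    by have := ler_wpM2l (ltW c_gt0) (sum_inv_sqrt_le R T); rewrite -/sT; lra.
  rewrite (eq_big_nat _ _ (F2 := fun t => c * sT^-1)) => [|t tT]; last exact: etaE.
  rewrite sumr_const_nat subSS subn0 -[_ *+ _]mulr_natr -mulrA.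
  have -> : T%:R = sT * sT by rewrite -expr2 sqr_sqrtr// ltW.
  have sT0 : 0 < sT by rewrite (lt_le_trans _ sT1).
  by rewrite mulKf ?gt_eqF//; have := mulr_ge0 (ltW c_gt0) (ltW sT0); lra.
have eta_r0 := learning_rate_gt0 N_gt0 lam01 lamE eta_rE.
set V := switching_variation _ _ _ _ _.
have Cge : 2 * (`|M| / c) <= C0 + 2 * (`|M| / c) + 1 by lra.
have sT0 : 0 < sT by rewrite (lt_le_trans _ sT1).
have alpha0 : 0 < (C0 + 2 * (`|M| / c) + 1) * sT by rewrite mulr_gt0//; lra.
have Malpha : 2 * M / eta T <= (C0 + 2 * (`|M| / c) + 1) * sT.
  by have := ler_wpM2r (ltW sT0) Cge; rewrite etaT Mabs; lra.
have := dfs_regret Theta_convex nrm_norm psi_C1 sigma_gt0 psi_strongly_convex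
  gpsi_bounded bregman_bounded N_gt0 mT f_sub r_sub G_bnd Phi_in Phi_contr
  lam01 eta_r0 eta_gt0 eta_nincr run theta_in alpha0 Malpha.
rewrite -[in G * _]Gabs -/b -/V; move=> regret; apply: le_trans regret _.
rewrite [leRHS]mulrDr lerD2r.
have mix := mixing_regret_le N_gt0 lam01 lamE eta_rE.
have var := variance_regret_le N_gt0 lam01 lamE eta_rE b.
rewrite -/sT -/sK in mix var.
(* Terms lacking the factor [sK] acquire it at the price of a factor 2, which explains the doubled
   constants in [C0]. *)
have u1 : sT <= 2 * (sK * sT) by have := ler_wpM2r (ltW sT0) sK1; lra.
have bu : 2 * b <= 4 * b * (sK * sT).
  have := ler_wpM2l b0 (le_trans sT1 u1); lra.
have Du : Dmax / eta T <= 2 * `|Dmax| / c * (sK * sT).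
  rewrite etaT; have := ler_wpM2l D0 u1.
  have : Dmax * (sT / c) <= `|Dmax| * (sT / c).
    by rewrite ler_wpM2r ?ler_norm// divr_ge0// ltW.
  lra.
have Gu : G ^+ 2 / (2 * sigma) * (\sum_(1 <= t < T.+1) eta t)
    <= 4 * (G ^+ 2 / (2 * sigma)) * c * (sK * sT).
  apply: le_trans (ler_wpM2l G0 sum_eta) _.
  have := ler_wpM2l (mulr_ge0 G0 (ltW c_gt0)) u1; lra.
have seg := ler_wpM2l (ler0n R m.+1) (lerD (lerD mix var) (lerD Du Gu)).
apply: (le_trans (lerD bu seg)).
apply: (@le_trans _ _ (C0 * (sK * sT))); first by rewrite /C0; lra.
rewrite -mulrA [sT * sK]mulrC ler_wpM2r//; last by lra.
by rewrite mulr_ge0 ?sqrtr_ge0// ltW.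
Qed.
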